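(* Let $K$ be a perfect field, $V_1,\dots,V_d$ finite-dimensional $K$-vector spaces and $V=V_1\otimes\cdots\otimes V_d$. For any tensor $v\in V$ we have $$\operatorname{rk}^G(v)\le\operatorname{srk}(v).$$
   Context: Slice rank: a nonzero tensor in $V$ has slice rank $1$ if it lies in $V_1\otimes\cdots\otimes V_{i-1}\otimes w\otimes V_{i+1}\otimes\cdots\otimes V_d$ for some $i$ and some $w\in V_i$. The slice rank $\operatorname{srk}(v)$ is the smallest $r\ge 0$ such that $v$ is a sum of $r$ tensors of slice rank $1$. $G$-stable rank: for a $K$-vector space $W$ and $v(t)\in K((t))\otimes W$, $\operatorname{val}_t(v(t))$ is the largest integer $m$ with $v(t)\in t^m(K[[t]]\otimes W)$, and $\operatorname{val}_t(0)=\infty$. Let $\mathrm{GL}(V_i,K[[t]])$ be the set of elements of $K[[t]]\otimes\operatorname{End}(V_i)$ that are invertible over $K((t))$ (the inverse need not have entries in $K[[t]]$), and $G(K[[t]])=\prod_i\mathrm{GL}(V_i,K[[t]])$, acting on $K((t))\otimes V$ factorwise. Then $\operatorname{rk}^G(v)$ is the infimum of $$\frac{\sum_{i=1}^d\operatorname{val}_t(\det g_i(t))}{\operatorname{val}_t(g(t)\cdot v)}$$ over all $g(t)=(g_1(t),\dots,g_d(t))\in G(K[[t]])$ with $\operatorname{val}_t(g(t)\cdot v)>0$ (a quotient with denominator $\infty$ is $0$). *)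

(* Defs.v *)
From HB Require Import structures.
From mathcomp Require Import all_boot all_order all_algebra all_field.
From mathcomp Require Import boolp classical_sets constructive_ereal reals ereal.

Set Implicit Arguments.
Unset Strict Implicit.
Unset Printing Implicit Defensive.

Import Order.TTheory GRing.Theory Num.Theory.
Local Open Scope classical_set_scope.
Local Open Scope ring_scope.

Definition perfect_field (K : fieldType) : Prop :=
  forall p : {poly K}, irreducible_poly p -> separable_poly p.

(* The power series ring K[[t]]: [f n] is the coefficient of t^n in [f]. The
   operations are the Cauchy product and the termwise sum, so [fps K] must not
   be confused with the pointwise ring structure on [nat -> K]. *)
Definition fps (K : fieldType) : Type := nat -> K.

Section FormalPowerSeries.
Variable K : fieldType.
Implicit Types f g h : fps K.

HB.instance Definition _ := gen_eqMixin (fps K).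
HB.instance Definition _ := gen_choiceMixin (fps K).

Definition fps_zero : fps K := fun _ => 0.
Definition fps_opp f : fps K := fun n => - f n.
Definition fps_add f g : fps K := fun n => f n + g n.
Definition fps_one : fps K := fun n => (n == 0%N)%:R.
Definition fps_mul f g : fps K := fun n => \sum_(i < n.+1) f i * g (n - i)%N.

Fact fps_addA : associative fps_add.
Proof. by move=> f g h; apply/funext => n; rewrite /fps_add addrA. Qed.
Fact fps_addC : commutative fps_add.
Proof. by move=> f g; apply/funext => n; rewrite /fps_add addrC. Qed.
Fact fps_add0 : left_id fps_zero fps_add.
Proof. by move=> f; apply/funext => n; rewrite /fps_add add0r. Qed.
Fact fps_addN : left_inverse fps_zero fps_opp fps_add.
Proof. by move=> f; apply/funext => n; rewrite /fps_add addNr. Qed.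

HB.instance Definition _ :=
  GRing.isZmodule.Build (fps K) fps_addA fps_addC fps_add0 fps_addN.

Definition fps_trunc (N : nat) f : {poly K} := \poly_(i < N) f i.

Fact fps_mul_trunc N f g n : (n < N)%N ->
  fps_mul f g n = (fps_trunc N f * fps_trunc N g)`_n.
Proof.
move=> nN; rewrite coefM; apply: eq_bigr => i _.
have iN : (i < N)%N by apply: leq_ltn_trans nN; rewrite -ltnS.
by rewrite !coef_poly iN (leq_ltn_trans (leq_subr _ _) nN).
Qed.

Fact fps_mulC : commutative fps_mul.
Proof.
by move=> f g; apply/funext => n; rewrite !(@fps_mul_trunc n.+1) // mulrC.
Qed.

Fact fps_mulA : associative fps_mul.
Proof.
move=> f g h; apply/funext => n.
rewrite (@fps_mul_trunc n.+1) // [RHS](@fps_mul_trunc n.+1) //.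
transitivity (fps_trunc n.+1 f * (fps_trunc n.+1 g * fps_trunc n.+1 h))`_n.
  rewrite !coefM; apply: eq_bigr => i _; congr (_ * _).
  by rewrite coef_poly ltnS leq_subr (@fps_mul_trunc n.+1) // ltnS leq_subr.
rewrite mulrA !coefM; apply: eq_bigr => i _; congr (_ * _).
by rewrite coef_poly ltn_ord (@fps_mul_trunc n.+1).
Qed.

Fact fps_mul1 : left_id fps_one fps_mul.
Proof.
move=> f; apply/funext => n; rewrite /fps_mul big_ord_recl /= mul1r subn0.
by rewrite big1 ?addr0 // => i _; rewrite /fps_one mul0r.
Qed.

Fact fps_mulDl : left_distributive fps_mul +%R.
Proof.
move=> f g h; apply/funext => n; rewrite -[RHS]big_split /=.
by apply: eq_bigr => i _; rewrite mulrDl.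
Qed.

Fact fps_one_neq0 : fps_one != 0.
Proof.
apply/eqP => /(congr1 (fun f : fps K => f 0%N)) /eqP.
by rewrite /fps_one /= oner_eq0.
Qed.

HB.instance Definition _ := GRing.Zmodule_isComNzRing.Build (fps K)
  fps_mulA fps_mulC fps_mul1 fps_mulDl fps_one_neq0.

Definition fps_unit : {pred fps K} := fun f => `[< exists g, g * f = 1 >].
Definition fps_inv f : fps K :=
  if pselect (exists g, g * f = 1) is left ex then projT1 (cid ex) else f.

Fact fps_mulVx : {in fps_unit, left_inverse 1 fps_inv *%R}.
Proof.
move=> f /asboolP fU; rewrite /fps_inv; case: pselect => // ex.
exact: projT2 (cid ex).
Qed.
Fact fps_unitPl f g : g * f = 1 -> fps_unit f.
Proof. by move=> gf; apply/asboolP; exists g. Qed.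
Fact fps_inv_out : {in [predC fps_unit], fps_inv =1 id}.
Proof.
move=> f /negP nU; rewrite /fps_inv; case: pselect => // ex.
by case: nU; apply/asboolP.
Qed.

HB.instance Definition _ := GRing.ComNzRing_hasMulInverse.Build (fps K)
  fps_mulVx fps_unitPl fps_inv_out.

Fact fps_order f : f != 0 ->
  exists2 n, f n != 0 & forall i, (i < n)%N -> f i = 0.
Proof.
move=> f0; have ex : exists n, f n != 0.
  apply: contrapT => nex; case/eqP: f0; apply/funext => n.
  by apply/eqP/negPn/negP => fn; apply: nex; exists n.
exists (ex_minn ex); case: ex_minnP => // n fn min_n i.
by apply: contraTeq => fi; rewrite -leqNgt min_n.
Qed.

Fact fps_mulf_eq0 f g : f * g = 0 -> (f == 0) || (g == 0).
Proof.
move=> fg0; apply/negPn/negP; rewrite negb_or => /andP[].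
move=> /fps_order[m fm ltm] /fps_order[n gn ltn].
have /eqP := congr1 (fun h : fps K => h (m + n)%N) fg0.
have mlt : (m < (m + n).+1)%N by rewrite ltnS leq_addr.
rewrite [X in X == _](bigD1 (Ordinal mlt)) //= addKn big1 ?addr0.
  by rewrite mulf_eq0 (negPf fm) (negPf gn).
move=> i /eqP neq_im; have [lt_im|] := ltnP i m; first by rewrite ltm ?mul0r.
rewrite leq_eqVlt => /orP[/eqP eq_mi|lt_mi].
  by case: neq_im; apply: val_inj.
rewrite [g _]ltn ?mulr0 // -(ltn_add2l i) subnKC ?ltn_add2r //.
by rewrite -ltnS ltn_ord.
Qed.

HB.instance Definition _ := GRing.ComUnitRing_isIntegral.Build (fps K)
  fps_mulf_eq0.

Definition fps_const (c : K) : fps K := fun n => if n == 0%N then c else 0.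
Definition fps_t : fps K := fun n => (n == 1%N)%:R.

End FormalPowerSeries.

(* K((t)) is the fraction field of K[[t]]. *)
Definition laurent (K : fieldType) : fieldType := {fraction (fps K)}.

Definition laurent_t (K : fieldType) : laurent K := tofrac (fps_t K).

Definition is_integral (K : fieldType) (a : laurent K) : Prop :=
  exists f : fps K, a = tofrac f.

(* For a K-vector space W with a finite basis indexed by I, K((t)) ⊗ W is
   identified with the coordinate vectors I -> K((t)), and K[[t]] ⊗ W with
   those whose entries are in K[[t]]. *)
Section Valuation.
Variables (K : fieldType) (I : finType).
Implicit Type w : I -> laurent K.

Definition in_t_lattice (m : int) w : Prop :=
  exists u : I -> laurent K, (forall x, is_integral (u x)) /\
    (forall x, w x = laurent_t K ^ m * u x).

Definition is_val_t w (m : int) : Prop :=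
  in_t_lattice m w /\ forall m', in_t_lattice m' w -> (m' <= m)%R.

(* The default value [0] of [xget] is never used: a nonzero vector over K((t))
   has a valuation. *)
Definition val_t w : \bar int :=
  if `[< forall x, w x = 0 >] then +oo%E
  else (xget 0 [set m | is_val_t w m])%:E.

End Valuation.

Definition val_t_scalar (K : fieldType) (a : laurent K) : \bar int :=
  val_t (fun _ : unit => a).

Section Tensors.
Variables (K : fieldType) (d : nat) (V : 'I_d.+1 -> vectType K).

(* Multi-indices: they index the basis of V_1 ⊗ ... ⊗ V_d made of the tensor
   products of the elements of the bases [vbasis {:V i}]. *)
Definition multi_index : finType :=
  {dffun forall i : 'I_d.+1, 'I_(\dim {:V i})}.

(* V_1 ⊗ ... ⊗ V_d, in coordinates on that basis *)
Definition tensor : vectType K := {ffun multi_index -> K^o}.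

Definition pure_tensor (u : forall i, V i) : tensor :=
  [ffun x : multi_index => \prod_i coord (vbasis {:V i}) (x i) (u i)].

(* V_1 ⊗ ... ⊗ V_(i-1) ⊗ w ⊗ V_(i+1) ⊗ ... ⊗ V_d, spanned by the pure tensors
   whose i-th factor is w *)
Definition in_slice (i : 'I_d.+1) (w : V i) (v : tensor) : Prop :=
  exists (n : nat) (c : 'I_n -> K) (u : 'I_n -> forall j, V j),
    (forall k, u k i = w) /\ v = \sum_(k < n) c k *: pure_tensor (u k).

Definition slice_rank_one (v : tensor) : Prop :=
  v != 0 /\ exists (i : 'I_d.+1) (w : V i), in_slice w v.

Definition sum_of_slices (v : tensor) (r : nat) : Prop :=
  exists s : 'I_r -> tensor,
    (forall k, slice_rank_one (s k)) /\ v = \sum_(k < r) s k.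

Fact ex_sum_of_slices (v : tensor) : exists r, `[< sum_of_slices v r >].
Proof.
pose e (x : multi_index) : tensor :=
  pure_tensor (fun i => (vbasis {:V i})`_(x i)).
have eE x y : e x y = (x == y)%:R.
  rewrite ffunE; have [<-|neq_xy] := eqVneq x y.
    by rewrite big1 // => i _; rewrite coord_free ?eqxx ?(basis_free (vbasisP _)).
  suff [i neq_i] : exists i, x i != y i.
    rewrite (bigD1 i) //= coord_free ?(basis_free (vbasisP _)) //.
    by rewrite (negPf neq_i) mul0r.
  apply/existsP; apply: contraR neq_xy; rewrite negb_exists => /forallP eq_xy.
  by apply/eqP/ffunP => i; apply/eqP; rewrite -[_ == _]negbK.
have eZ (a : K) x y : (a *: e x) y = a * (x == y)%:R.
  by rewrite -eE; exact: ffunE.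
pose A := [set x | v x != 0]%SET.
exists #|A|; apply/asboolP.
exists (fun k : 'I_#|A| => (v (enum_val k) : K) *: e (enum_val k)); split.
  move=> k; have := enum_valP k; rewrite inE => vk0; split.
    apply: contra_neq vk0 => /ffunP/(_ (enum_val k)).
    by rewrite eZ ffunE eqxx mulr1.
  exists ord0, (vbasis {:V ord0})`_(enum_val k ord0), 1%N.
  exists (fun=> v (enum_val k)), (fun _ i => (vbasis {:V i})`_(enum_val k i)).
  by split=> //; rewrite big_ord1.
rewrite -(big_enum_val (fun x => (v x : K) *: e x)) /=.
apply/ffunP => y; rewrite sum_ffunE.
under eq_bigr do rewrite eZ.
have [yA|yA] := boolP (y \in A).
  rewrite (bigD1 y) //= eqxx big1 => [|x /andP[_ /negPf->]].
    by rewrite addr0 mulr1.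
  by rewrite mulr0.
rewrite big1 => [|x xA]; first by move: yA; rewrite inE negbK => /eqP.
by case: eqP => [xy|_]; [rewrite -xy xA in yA | rewrite mulr0].
Qed.

Definition srk (v : tensor) : nat := ex_minn (ex_sum_of_slices v).

(* Elements of the product of the K((t)) ⊗ End(V_i), as matrices in the bases
   [vbasis {:V i}]; matrices act on column vectors. *)
Definition end_tuple : Type :=
  forall i : 'I_d.+1, 'M[laurent K]_(\dim {:V i}).

Definition in_G (g : end_tuple) : Prop :=
  forall i, (forall a b, is_integral (g i a b)) /\ g i \in unitmx.

(* g_1 ⊗ ... ⊗ g_d acting on K((t)) ⊗ V_1 ⊗ ... ⊗ V_d *)
Definition act (g : end_tuple) (w : multi_index -> laurent K) :
    multi_index -> laurent K :=
  fun x => \sum_(y : multi_index) (\prod_i g i (x i) (y i)) * w y.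

(* v |-> 1 ⊗ v, from V to K((t)) ⊗ V *)
Definition extend_scalars (v : tensor) : multi_index -> laurent K :=
  fun x => tofrac (@fps_const K (v x)).

(* With the conventions of extended reals, [x / +oo = 0]. *)
Definition rkG (R : realType) (v : tensor) : \bar R :=
  let toR := er_map (fun m : int => m%:~R : R) in
  ereal_inf [set q : \bar R | exists g : end_tuple,
    [/\ in_G g,
        (0 < val_t (act g (extend_scalars v)))%E &
        q = (toR (\sum_i val_t_scalar (\det (g i)))%E
             / toR (val_t (act g (extend_scalars v))))%E]].

End Tensors.

(* Main.v *)
Require Import Defs.
From HB Require Import structures.
From mathcomp Require Import all_boot all_order all_algebra all_field.
From mathcomp Require Import boolp classical_sets constructive_ereal reals ereal.

(** A decomposition of [v] into [r] slices itself provides a one-parameter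
    degeneration [g(t)] whose quotient is at most [r]. Let the [k]-th slice be
    a combination of pure tensors whose factor in position [i_k] is [w_k], and
    let [W_i] be the span in [V_i] of the [w_k] with [i_k = i]. Take [g_i(t)]
    to be an automorphism of [V_i] over [K] which moves [W_i] onto a coordinate
    subspace, followed by the multiplication by [t] of the coordinates of this
    subspace. Then
    - [det g_i(t)] is a nonzero constant times [t ^ dim W_i]
      ([val_det_degen]), so the numerator of the quotient is the sum of the
      [dim W_i], which is at most the number [r] of slices;
    - [g_i(t)] maps every [w_k] with [i_k = i] into [t K[[t]] ⊗ V_i]
      ([degen_row]), hence [g(t)] maps the [k]-th slice into [t K[[t]] ⊗ V]
      ([act_slice]), and [g(t) v] has valuation at least 1.
    The quotient is therefore at most [r] ([rkG_le]), also when [g(t) v = 0],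
    as it is then [0].

    In coordinates the [w_k] with [i_k = i] are the rows of a matrix [M], and
    the Gaussian elimination of [M] supplies the automorphism. *)

Set Implicit Arguments.
Unset Strict Implicit.
Unset Printing Implicit Defensive.

Import Order.TTheory GRing.Theory Num.Theory.
Local Open Scope ring_scope.

(** * Products of sums over dependent families *)

(** [bigA_distr_big_dep] is about functions with a fixed codomain; the proof
    passes through the functions into the disjoint union of the [T_ i] that
    respect the tags, where that lemma applies. *)
Lemma prod_sum_dffun (R : comNzRingType) (I : finType) (T_ : I -> finType)
    (F : forall i, T_ i -> R) :
  \prod_i \sum_j F i j =
  \sum_(f : {dffun forall i, T_ i}) \prod_i F i (f i).
Proof.
rewrite (reindex (@dffun_of_fprod I T_)) /=; last first.
  exact/onW_bij/dffun_of_fprod_bij.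
pose P i : {ffun T_ i -> R} := [ffun j => F i j].
transitivity (\sum_(t : fprod T_) \prod_(i in I) P i (t i)).
  rewrite big_fprod -(bigA_distr_big_dep _ (fun i => untag 0 (P i))).
  apply: eq_bigr => i _.
  rewrite -(big_tag (fun i => P i)).
  by apply: eq_bigr => j _; rewrite ffunE.
by apply: eq_bigr => t _; apply: eq_bigr => i _; rewrite !ffunE.
Qed.

(** * Laurent series and their valuation *)

Section Laurent.
Variable K : fieldType.

Definition laurent_const (c : K) : laurent K := tofrac (fps_const c).

Fact laurent_const_zmod_morphism : zmod_morphism laurent_const.
Proof.
move=> a b; rewrite /laurent_const -tofracB; congr tofrac; apply/funext => n.
rewrite /fps_const -[RHS]/(_ + - _); by case: eqP => // _; rewrite subr0.
Qed.
HB.instance Definition _ :=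
  GRing.isZmodMorphism.Build K (laurent K) laurent_const
    laurent_const_zmod_morphism.

Fact laurent_const_monoid_morphism : monoid_morphism laurent_const.
Proof.
split=> [|a b]; rewrite /laurent_const.
  rewrite -tofrac1; congr tofrac; apply/funext => n.
  by rewrite /fps_const -[RHS]/((n == 0%N)%:R); case: eqP.
rewrite -tofracM; congr tofrac; apply/funext => n.
rewrite -[RHS]/(\sum_(i < n.+1) _) big_ord_recl /= subn0.
rewrite big1 => [|i _]; last by rewrite /fps_const /= mul0r.
by rewrite addr0 /fps_const /=; case: eqP => // _; rewrite mulr0.
Qed.
HB.instance Definition _ :=
  GRing.isMonoidMorphism.Build K (laurent K) laurent_const
    laurent_const_monoid_morphism.

Lemma is_integral_laurent_const c : is_integral (laurent_const c).
Proof. by exists (fps_const c). Qed.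

Lemma is_integral_laurent_t : is_integral (laurent_t K).
Proof. by exists (fps_t K). Qed.

Lemma is_integral0 : is_integral (0 : laurent K).
Proof. by exists 0; rewrite tofrac0. Qed.

Lemma is_integral1 : is_integral (1 : laurent K).
Proof. by exists 1; rewrite tofrac1. Qed.

Lemma is_integralD (a b : laurent K) :
  is_integral a -> is_integral b -> is_integral (a + b).
Proof. by move=> [f ->] [g ->]; exists (f + g); rewrite tofracD. Qed.

Lemma is_integralM (a b : laurent K) :
  is_integral a -> is_integral b -> is_integral (a * b).
Proof. by move=> [f ->] [g ->]; exists (f * g); rewrite tofracM. Qed.

Lemma is_integral_sum (I : Type) (r : seq I) (P : pred I)
    (F : I -> laurent K) :
  (forall i, P i -> is_integral (F i)) -> is_integral (\sum_(i <- r | P i) F i).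
Proof.
by move=> FI; apply: (@big_ind _ (@is_integral K)) => //;
  [exact: is_integral0 | exact: is_integralD].
Qed.

Lemma is_integral_prod (I : Type) (r : seq I) (P : pred I)
    (F : I -> laurent K) :
  (forall i, P i -> is_integral (F i)) ->
  is_integral (\prod_(i <- r | P i) F i).
Proof.
by move=> FI; apply: (@big_ind _ (@is_integral K)) => //;
  [exact: is_integral1 | exact: is_integralM].
Qed.

Lemma laurent_t_neq0 : laurent_t K != 0.
Proof.
rewrite tofrac_eq0; apply/eqP => /(congr1 (fun f : fps K => f 1%N)) /eqP.
by rewrite -[_ == _]/(1 == 0 :> K) oner_eq0.
Qed.

Lemma fps_t_mul_coef0 (f : fps K) : (fps_t K * f) 0%N = 0.
Proof.
by rewrite -[LHS]/(\sum_(i < 1) _) big_ord1 /fps_t mul0r.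
Qed.

Lemma fps_t_mul_coefS (f : fps K) n : (fps_t K * f) n.+1 = f n.
Proof.
rewrite -[LHS]/(\sum_(i < n.+2) _) !big_ord_recl /= big1 => [|i _].
  by rewrite /fps_t mul0r mul1r add0r addr0 subSS subn0.
by rewrite /fps_t /= mul0r.
Qed.

Lemma fps_tX_mul_coef (f : fps K) k n : (n < k)%N -> (fps_t K ^+ k * f) n = 0.
Proof.
elim: k n => [//|k IHk] [|n] nk; rewrite exprS -mulrA.
  exact: fps_t_mul_coef0.
by rewrite fps_t_mul_coefS IHk.
Qed.

(** The order of a power series bounds the power of [t] which can be factored
    out of it: this bounds valuations from above. *)
Lemma le_coef_neq0 (f : fps K) n (k : int) (a : laurent K) :
  is_integral a -> tofrac f = laurent_t K ^ k * a -> f n != 0 -> k <= n%:Z.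
Proof.
move=> [h ->]; case: k => [k|//] E.
apply: contraNT; rewrite -ltNge ltz_nat => nk; apply/eqP.
suff -> : f = fps_t K ^+ k * h by exact: fps_tX_mul_coef.
by apply/eqP; rewrite -tofrac_eq tofracM tofracXn E.
Qed.

Section Valuation.
Variable I : finType.
Implicit Type w : I -> laurent K.

Lemma val_tE w m x : is_val_t w m -> w x != 0 -> val_t w = m%:E.
Proof.
move=> [wm wmax] wx; rewrite /val_t asboolF.
  congr EFin; apply: xget_unique => // m' [wm' wmax'].
  by apply/eqP; rewrite eq_le wmax ?wmax'.
by move=> /(_ x) /eqP; rewrite (negPf wx).
Qed.

(** The integers [m] such that [w] lies in the [m]-th lattice are bounded by
    the order of any nonzero coordinate, so there is a largest one. *)
Lemma ex_val_t w m0 x : in_t_lattice m0 w -> w x != 0 ->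
  exists2 m, is_val_t w m & m0 <= m.
Proof.
move=> wm0 wx; have [u [uI uE]] := wm0; have [f fE] := uI x.
have f0 : f != 0.
  by apply: contraNneq wx => f0; rewrite uE fE f0 tofrac0 mulr0.
have [n fn _] := fps_order f0.
have bnd m : in_t_lattice m w -> m <= m0 + n%:Z.
  move=> [u' [u'I u'E]]; rewrite -lerBlDl.
  apply: (le_coef_neq0 (u'I x) _ fn); rewrite -fE.
  apply: (mulfI (expfz_neq0 m0 laurent_t_neq0)); rewrite -uE u'E mulrA.
  by rewrite -expfzDr ?laurent_t_neq0 // addrC subrK.
pose P k := `[< in_t_lattice (m0 + k%:Z) w >].
have exP : exists k, P k by exists 0%N; apply/asboolP; rewrite addr0.
have bndP k : P k -> (k <= n)%N.
  by move=> /asboolP/bnd; rewrite lerD2l lez_nat.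
case: (ex_maxnP exP bndP) => k /asboolP wk kmax.
exists (m0 + k%:Z); last by rewrite lerDl.
split=> // m wm; have [|/ltW m0m] := leP m m0.
  by move/le_trans; apply; rewrite lerDl.
have -> : m = m0 + `|m - m0|%N%:Z by rewrite gez0_abs ?subr_ge0 // subrKC.
rewrite lerD2l lez_nat; apply: kmax; apply/asboolP.
by rewrite gez0_abs ?subr_ge0 // subrKC.
Qed.

Lemma val_t_ge w m0 : in_t_lattice m0 w ->
  val_t w = +oo%E \/ exists2 m, val_t w = m%:E & m0 <= m.
Proof.
move=> wm0; have [w0|] := pselect (forall x, w x = 0).
  by left; rewrite /val_t asboolT.
move=> /existsNP[x /eqP wx]; right.
by have [m wm m0m] := ex_val_t wm0 wx; exists m => //; exact: val_tE wm wx.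
Qed.

End Valuation.

Lemma val_t_scalar_monomial (c : K) (m : nat) : c != 0 ->
  val_t_scalar (laurent_t K ^+ m * laurent_const c) = m%:Z%:E.
Proof.
move=> c0; apply: (@val_tE _ _ _ tt); last first.
  by rewrite mulf_neq0 ?expf_neq0 ?laurent_t_neq0 ?fmorph_eq0.
split=> [|m' [u [uI uE]]].
  exists (fun=> laurent_const c); split=> // _.
  exact: is_integral_laurent_const.
rewrite -subr_le0; apply: (@le_coef_neq0 (fps_const c) 0 _ _ (uI tt)) => //.
apply: (mulfI (expf_neq0 m laurent_t_neq0)); rewrite (uE tt) mulrA.
by rewrite exprnP -expfzDr ?laurent_t_neq0 // addrC subrK.
Qed.

End Laurent.

(** * A degeneration scaling a given subspace by t *)

Section Degeneration.
Variables (K : fieldType) (n : nat).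

(** Acts on column vectors, hence the transpose: it moves the row space of [M]
    onto the span of the first [\rank M] coordinate vectors. *)
Definition compress p (M : 'M[K]_(p, n)) : 'M[K]_n := (invmx (row_ebase M))^T.

Lemma compress_unit p (M : 'M[K]_(p, n)) : compress M \in unitmx.
Proof. by rewrite unitmx_tr unitmx_inv row_ebase_unit. Qed.

(** Since [M = col_ebase M *m pid_mx (\rank M) *m row_ebase M], the matrix
    [M *m invmx (row_ebase M)] has no nonzero column beyond the first
    [\rank M] ones. *)
Lemma compress_row p (M : 'M[K]_(p, n)) k (a : 'I_n) : (\rank M <= a)%N ->
  \sum_b compress M a b * M k b = 0.
Proof.
move=> ra; transitivity ((M *m invmx (row_ebase M)) k a).
  by rewrite mxE; apply: eq_bigr => b _; rewrite mxE mulrC.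
rewrite -{1}[M]mulmx_ebase mulmxK ?row_ebase_unit // mxE big1 // => b _.
rewrite [pid_mx _ b a]mxE; case: eqP => [ba|_]; last by rewrite mulr0.
by rewrite /= ltnNge ba ra mulr0.
Qed.

Definition degen p (M : 'M[K]_(p, n)) : 'M[laurent K]_n :=
  diag_mx (\row_a (if (a < \rank M)%N then laurent_t K else 1))
  *m map_mx (@laurent_const K) (compress M).

Lemma degenE p (M : 'M[K]_(p, n)) a b : degen M a b =
  (if (a < \rank M)%N then laurent_t K else 1) * laurent_const (compress M a b).
Proof. by rewrite /degen mul_diag_mx !mxE. Qed.

Lemma det_degen p (M : 'M[K]_(p, n)) :
  \det (degen M) =
  laurent_t K ^+ \rank M * laurent_const (\det (compress M)).
Proof.
rewrite det_mulmx det_diag det_map_mx; congr (_ * _).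
under eq_bigr do rewrite mxE.
rewrite -big_mkcond /= prodr_const; congr (_ ^+ _).
rewrite -sum1_card (big_ord_narrow (rank_leq_col M)) /=.
by rewrite sum1_card card_ord.
Qed.

Lemma degen_unit p (M : 'M[K]_(p, n)) : degen M \in unitmx.
Proof.
rewrite unitmxE unitfE det_degen mulf_neq0 ?expf_neq0 ?laurent_t_neq0 //.
by rewrite fmorph_eq0 -unitfE -unitmxE compress_unit.
Qed.

Lemma val_det_degen p (M : 'M[K]_(p, n)) :
  val_t_scalar (\det (degen M)) = (\rank M)%:Z%:E.
Proof.
rewrite det_degen val_t_scalar_monomial //.
by rewrite -unitfE -unitmxE compress_unit.
Qed.

Lemma degen_integral p (M : 'M[K]_(p, n)) a b : is_integral (degen M a b).
Proof.
rewrite degenE; apply: is_integralM; last exact: is_integral_laurent_const.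
by case: ifP => _; [exact: is_integral_laurent_t | exact: is_integral1].
Qed.

(** The coordinates of the image of a row of [M] are multiplied by [t] where
    [compress_row] does not make them vanish. *)
Lemma degen_row p (M : 'M[K]_(p, n)) k a : exists2 h, is_integral h &
  \sum_b degen M a b * laurent_const (M k b) = laurent_t K * h.
Proof.
exists (if (a < \rank M)%N
        then laurent_const (\sum_b compress M a b * M k b) else 0).
  by case: ifP => _; [exact: is_integral_laurent_const | exact: is_integral0].
under eq_bigr do rewrite degenE -mulrA -rmorphM.
rewrite -mulr_sumr -rmorph_sum; case: ltnP => // ra.
by rewrite compress_row // rmorph0 !mulr0.
Qed.

End Degeneration.

(** * The action on slices and the bound *)

Section Action.
Variables (K : fieldType) (d : nat) (V : 'I_d.+1 -> vectType K).
Implicit Types (g : end_tuple V) (v : tensor V).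

Lemma act_pure_tensor g (u : forall i, V i) x :
  act g (extend_scalars (pure_tensor u)) x =
  \prod_i \sum_b g i (x i) b * laurent_const (coord (vbasis {:V i}) b (u i)).
Proof.
rewrite prod_sum_dffun; apply: eq_bigr => y _.
rewrite /extend_scalars ffunE -[tofrac _]/(laurent_const _).
by rewrite rmorph_prod -big_split.
Qed.

Lemma act_sum g n (c : 'I_n -> K) (v : 'I_n -> tensor V) x :
  act g (extend_scalars (\sum_k c k *: v k)) x =
  \sum_k laurent_const (c k) * act g (extend_scalars (v k)) x.
Proof.
rewrite /act; under [RHS]eq_bigr do rewrite mulr_sumr.
rewrite exchange_big; apply: eq_bigr => y _.
rewrite /extend_scalars -[tofrac _]/(laurent_const _) sum_ffunE rmorph_sum.
rewrite mulr_sumr; apply: eq_bigr => k _ /=.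
have -> : (c k *: v k) y = c k * v k y by exact: ffunE.
by rewrite rmorphM mulrCA.
Qed.

(** In the image of a pure tensor with [i]-th factor [w], each coordinate is a
    product over all positions; position [i] supplies the factor [t] and the
    others are integral. *)
Lemma act_slice g i (w : V i) v x :
  (forall j a b, is_integral (g j a b)) ->
  (forall a, exists2 h, is_integral h &
    \sum_b g i a b * laurent_const (coord (vbasis {:V i}) b w)
      = laurent_t K * h) ->
  in_slice w v ->
  exists2 h, is_integral h & act g (extend_scalars v) x = laurent_t K * h.
Proof.
move=> gI gw [n [c [u [uw ->]]]]; have [h hI hE] := gw (x i).
pose F k j := \sum_b g j (x j) b *
  laurent_const (coord (vbasis {:V j}) b (u k j)).
exists (\sum_k laurent_const (c k) * (h * \prod_(j | j != i) F k j)).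
  apply: is_integral_sum => k _.
  apply: is_integralM; first exact: is_integral_laurent_const.
  apply: is_integralM => //; apply: is_integral_prod => j _.
  apply: is_integral_sum => b _; apply: is_integralM => //.
  exact: is_integral_laurent_const.
rewrite act_sum mulr_sumr; apply: eq_bigr => k _.
rewrite act_pure_tensor (bigD1 i) //= uw hE.
by rewrite -/(F k) !mulrA [laurent_t K * _]mulrC.
Qed.

Lemma rkG_le (R : realType) g v (N : nat) :
  in_G g -> \sum_i val_t_scalar (\det (g i)) = N%:Z%:E ->
  in_t_lattice 1 (act g (extend_scalars v)) ->
  (rkG R v <= (N%:R : R)%:E)%E.
Proof.
move=> gG gN gv; have [wy|[m wm m1]] := val_t_ge gv.
  (* A zero tensor has valuation [+oo], and [x / +oo = 0]. *)
  apply: (@le_trans _ _ 0%E); last by rewrite lee_fin ler0n.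
  apply: ereal_inf_lbound; exists g; split=> //; first by rewrite wy.
  by rewrite wy /= invey mule0.
apply: (@le_trans _ _ (N%:R / m%:~R)%:E).
  apply: ereal_inf_lbound; exists g; split=> //.
    by rewrite wm lte_fin (lt_le_trans _ m1).
  rewrite gN wm /= inver ifF ?EFinM //.
  by apply/negbTE; rewrite intr_eq0 gt_eqF // (lt_le_trans _ m1).
rewrite lee_fin ler_piMr ?ler0n // invf_le1 ?ler1z //.
by rewrite ltr0z (lt_le_trans _ m1).
Qed.

Lemma sum_of_slices_rkG_le (R : realType) v r :
  sum_of_slices v r -> (rkG R v <= (r%:R : R)%:E)%E.
Proof.
move=> [s [s1 ->]].
(* The position and the vector of each slice; the type of the vector depends
   on the position, hence the tagged pairs. *)
have /choice[sg sgP] : forall k, exists iw : {i & V i},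
    in_slice (tagged iw) (s k).
  by move=> k; have [_ [i [w ws]]] := s1 k; exists (Tagged V w).
pose A i := [set k : 'I_r | tag (sg k) == i]%SET.
(* Rows are indexed by the slices in position [i] only, which makes the rank of
   [M i] at most their number; the default value of [untag] is not reached. *)
pose M i : 'M[K]_(#|A i|, \dim {:V i}) :=
  \matrix_(a < #|A i|, b < \dim {:V i}) coord (vbasis {:V i}) b
      (untag (T_ := fun j => V j) (0 : V i) id (sg (enum_val a))).
pose g : end_tuple V := fun i => degen (M i).
have gI j a b : is_integral (g j a b) by exact: degen_integral.
pose N := (\sum_i \rank (M i))%N.
have NE : \sum_i val_t_scalar (\det (g i)) = N%:Z%:E.
  under eq_bigr do rewrite val_det_degen.
  by rewrite sumEFin /N (big_morph Posz PoszD (erefl _)).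
have Nr : (N <= r)%N.
  rewrite -[leqRHS](card_ord r) -sum1_card.
  rewrite (partition_big (fun k => tag (sg k)) predT) //=.
  apply: leq_sum => i _; rewrite sum1dep_card.
  exact: leq_trans (rank_leq_row _) _.
apply: (@le_trans _ _ (N%:R : R)%:E); last by rewrite lee_fin ler_nat.
apply: (@rkG_le R g) => //.
  by move=> i; split=> //; exact: degen_unit.
have /choice[h hP] : forall x, exists h, is_integral h /\
    act g (extend_scalars (\sum_k s k)) x = laurent_t K ^ 1 * h.
  move=> x.
  have /choice[h hP] : forall k, exists h, is_integral h /\
      act g (extend_scalars (s k)) x = laurent_t K * h.
    move=> k; suff [h hI hE] : exists2 h, is_integral h &
      act g (extend_scalars (s k)) x = laurent_t K * h by exists h.
    apply: act_slice (sgP k) => // a.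
    have kA : k \in A (tag (sg k)) by rewrite inE.
    have [h hI hE] := degen_row (M (tag (sg k))) (enum_rank_in kA k) a.
    exists h => //; rewrite -hE; apply: eq_bigr => b _.
    rewrite [M _ _ _]mxE enum_rankK_in //.
    by rewrite (untagE _ _ (erefl (tag (sg k)))).
  exists (\sum_k h k); split.
    by apply: is_integral_sum => k _; case: (hP k).
  under [X in extend_scalars X]eq_bigr do rewrite -[s _]scale1r.
  rewrite act_sum expr1z mulr_sumr; apply: eq_bigr => k _.
  by rewrite rmorph1 mul1r; case: (hP k).
by exists h; split=> x; case: (hP x).
Qed.

End Action.

Theorem corollary3p7 (R : realType) (K : fieldType) (hK : perfect_field K)
    (d : nat) (V : 'I_d.+1 -> vectType K) (v : tensor V) :
  (rkG R v <= ((srk v)%:R : R)%:E)%E.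
Proof.
rewrite /srk; case: ex_minnP => r /asboolP v_r _.
exact: sum_of_slices_rkG_le.
Qed.
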